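(* Let $G$ be a finite directed graph, $\mathcal H$ its monoid of hikes and $\mu$ the Möbius function on $\mathcal H$. Let $f:\mathcal H\to\mathbb R$ be a totally multiplicative function, i.e. $f(h.h')=f(h)f(h')$ for all $h,h'\in\mathcal H$. The inverse of $f$ through the Dirichlet convolution is given by $$f^{-1}=\mu f: h\mapsto\mu(h)f(h),\quad h\in\mathcal H.$$
   Context: Let $G=(V,E)$ be a finite directed graph with $V=\{v_1,\dots,v_N\}$ and $E\subseteq V^2$ (loops allowed). Each arc $(v_i,v_j)\in E$ is identified with a letter $w_{ij}$. Let $\mathcal M$ be the trace monoid generated by the arcs, i.e. the quotient of the free monoid on the arcs by the relations $w_{ij}w_{kl}=w_{kl}w_{ij}$ for $i\neq k$. A hike is an element $h=w_{i_1j_1}\cdots w_{i_\ell j_\ell}$ of $\mathcal M$ such that for each $i$, $\#\{k: i_k=i\}=\#\{k: j_k=i\}$. The hikes form a submonoid $\mathcal H$ of $\mathcal M$, containing the empty hike $1$; the product of hikes $h,h'$ is written $h.h'$. A simple cycle is a hike of the form $w_{i_1i_2}w_{i_2i_3}\cdots w_{i_\ell i_1}$ with $\ell\ge1$ and $i_1,\dots,i_\ell$ pairwise distinct. For $d,h\in\mathcal H$, $d\mid h$ means $h=d.h'$ for some (necessarily unique) $h'\in\mathcal H$, denoted $h/d$. The Dirichlet convolution of $f,g:\mathcal H\to\mathbb R$ is $f*g(h)=\sum_{d\mid h}f(d)g(h/d)$; it is associative with identity $\delta$, where $\delta(1)=1$ and $\delta(h)=0$ for $h\ne1$. The Möbius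 function $\mu$ is the inverse of the constant function $1$ for $*$; explicitly, $\mu(1)=1$, $\mu(h)=(-1)^{k}$ if $h$ is a product of $k$ pairwise vertex-disjoint simple cycles, and $\mu(h)=0$ otherwise.
   Formalization: The totally multiplicative function f is additionally assumed not identically zero: the zero function satisfies f(h.h')=f(h)f(h') but has no inverse for the Dirichlet convolution. *)

(* Defs.v *)
From HB Require Import structures.
From mathcomp Require Import all_boot all_order all_algebra.
From mathcomp Require Import all_classical all_reals.
From mathcomp Require Import ring.

Set Implicit Arguments.
Unset Strict Implicit.
Unset Printing Implicit Defensive.

Import Order.TTheory GRing.Theory Num.Theory.
Local Open Scope classical_set_scope.
Local Open Scope ring_scope.
Local Open Scope quotient_scope.

Definition arc (V : finType) (E : {set V * V}) : finType := {a | a \in E}.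

Definition arc_src (V : finType) (E : {set V * V}) (a : arc E) : V := (val a).1.
Definition arc_tgt (V : finType) (E : {set V * V}) (a : arc E) : V := (val a).2.

Inductive trace_eq (V : finType) (E : {set V * V}) :
    seq (arc E) -> seq (arc E) -> Prop :=
| trace_eq_refl s : trace_eq s s
| trace_eq_sym s t : trace_eq s t -> trace_eq t s
| trace_eq_trans t s u : trace_eq s t -> trace_eq t u -> trace_eq s u
| trace_eq_swap s a b t : arc_src a != arc_src b ->
    trace_eq (s ++ a :: b :: t) (s ++ b :: a :: t).

Section TraceEq.
Variables (V : finType) (E : {set V * V}).
Implicit Types s t u w : seq (arc E).

Definition out_arcs (i : V) s := [seq a <- s | arc_src a == i].

Lemma trace_eq_perm s t : trace_eq s t -> perm_eq s t.
Proof.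
elim=> {s t} [s | s t _ | t s u _ st _ tu | s a b t _] //.
- by rewrite perm_sym.
- exact: perm_trans st tu.
- by rewrite perm_cat2l -[_ :: _]/([:: a] ++ [:: b] ++ t)
    -[b :: a :: t]/([:: b] ++ [:: a] ++ t) perm_catCA.
Qed.

Lemma trace_eq_out s t : trace_eq s t -> forall i, out_arcs i s = out_arcs i t.
Proof.
elim=> {s t} [s | s t _ IH | t s u _ st _ tu | s a b t ab] i //.
- by rewrite st.
- rewrite /out_arcs !filter_cat /=; congr (_ ++ _).
  by case: eqP => // ai; case: eqP => // bi; rewrite ai bi eqxx in ab.
Qed.

Lemma trace_eq_cat s s' t t' :
  trace_eq s s' -> trace_eq t t' -> trace_eq (s ++ t) (s' ++ t').
Proof.
move=> ss' tt'; apply: (@trace_eq_trans _ _ (s' ++ t)).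
- elim: ss' => [r | r r' _ | r' r u _ IH1 _ IH2 | r a b u ab].
  + exact: trace_eq_refl.
  + exact: trace_eq_sym.
  + exact: trace_eq_trans IH1 IH2.
  + by rewrite -!catA; apply: trace_eq_swap.
- elim: tt' => [r | r r' _ | r' r u _ IH1 _ IH2 | r a b u ab].
  + exact: trace_eq_refl.
  + exact: trace_eq_sym.
  + exact: trace_eq_trans IH1 IH2.
  + by rewrite !catA; apply: trace_eq_swap.
Qed.

Lemma trace_eq_front a s t : all (fun b => arc_src b != arc_src a) s ->
  trace_eq (s ++ a :: t) (a :: s ++ t).
Proof.
elim: s => [|b s IH] /= => [_|/andP[ba /IH {}IH]]; first exact: trace_eq_refl.
apply: (@trace_eq_trans _ _ (b :: a :: s ++ t)).
  by apply: (@trace_eq_cat [:: b] [:: b]) => //; apply: trace_eq_refl.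
exact: (@trace_eq_swap _ _ [::]).
Qed.

Lemma trace_eqP s t :
  trace_eq s t <-> forall i, out_arcs i s = out_arcs i t.
Proof.
split=> [|st]; first exact: trace_eq_out.
elim: s t st => [|a s IH] t st.
  case: t st => [_|a t /(_ (arc_src a))]; first exact: trace_eq_refl.
  by rewrite /out_arcs /= eqxx.
have ht : has (fun b => arc_src b == arc_src a) t.
  by rewrite has_filter -/(out_arcs _ t) -st /out_arcs /= eqxx.
case: (split_find ht) st => b t1 t2 /eqP ba nt1.
rewrite cat_rcons => st.
have o1 : out_arcs (arc_src a) t1 = [::].
  by apply/eqP; move: nt1; rewrite has_filter negbK.
have := st (arc_src a).
rewrite /out_arcs filter_cat -/(out_arcs _ t1) o1 /= ba !eqxx => -[ab _].
apply/trace_eq_sym; rewrite -ab in st *.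
have at1 : all (fun b => arc_src b != arc_src a) t1 by rewrite all_predC.
apply: trace_eq_trans (trace_eq_front t2 at1) _.
apply: (@trace_eq_cat [:: a] [:: a]); first exact: trace_eq_refl.
apply/trace_eq_sym/IH => i; have := st i.
rewrite (trace_eq_out (trace_eq_front t2 at1)) /out_arcs /=.
by case: ifP => _ // [].
Qed.

Lemma trace_eq_catI s t t' : trace_eq (s ++ t) (s ++ t') -> trace_eq t t'.
Proof.
move=> /trace_eqP st; apply/trace_eqP => i; have := st i.
by rewrite /out_arcs !filter_cat => /eqP; rewrite eqseq_cat// eqxx => /eqP.
Qed.

Definition trace_eqb s t : bool := `[< trace_eq s t >].

Lemma trace_eqb_refl : reflexive trace_eqb.
Proof. by move=> s; apply/asboolP/trace_eq_refl. Qed.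

Lemma trace_eqb_sym : symmetric trace_eqb.
Proof. by move=> s t; apply/asboolP/asboolP => /trace_eq_sym. Qed.

Lemma trace_eqb_trans : transitive trace_eqb.
Proof.
by move=> t s u /asboolP st /asboolP tu; apply/asboolP/(trace_eq_trans st tu).
Qed.

Canonical trace_equiv :=
  EquivRel trace_eqb trace_eqb_refl trace_eqb_sym trace_eqb_trans.

Definition trace := {eq_quot trace_equiv}.
HB.instance Definition _ := Choice.on trace.
HB.instance Definition _ := Quotient.on trace.
HB.instance Definition _ := EqQuotient.on trace.

Lemma trace_piP s t : \pi_trace s = \pi_trace t <-> trace_eq s t.
Proof.
by split=> [/eqmodP/asboolP|st] //; apply/eqmodP/asboolP.
Qed.

Lemma trace_repr s : trace_eq (repr (\pi_trace s)) s.
Proof. by apply/trace_piP; rewrite reprK. Qed.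

Definition trace_one : trace := \pi_trace [::].
Definition trace_mul (x y : trace) : trace := \pi_trace (repr x ++ repr y).

Lemma trace_mul_pi s t :
  trace_mul (\pi_trace s) (\pi_trace t) = \pi_trace (s ++ t).
Proof. by apply/trace_piP/trace_eq_cat; apply: trace_repr. Qed.

Lemma trace_mulA : associative trace_mul.
Proof.
move=> x y z; rewrite -[x]reprK -[y]reprK -[z]reprK.
rewrite (trace_mul_pi (repr y)) (trace_mul_pi (repr x) (repr y)).
by rewrite !trace_mul_pi catA.
Qed.

Lemma trace_mul1 : left_id trace_one trace_mul.
Proof. by move=> x; rewrite -[x]reprK trace_mul_pi. Qed.

Lemma trace_mulr1 : right_id trace_one trace_mul.
Proof. by move=> x; rewrite -[x]reprK trace_mul_pi cats0. Qed.

HB.instance Definition _ :=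
  isMonoid.Build trace trace_mulA trace_mul1 trace_mulr1.

Definition is_hike (x : trace) : bool :=
  [forall i, count (fun a => arc_src a == i) (repr x)
          == count (fun a => arc_tgt a == i) (repr x)].

Lemma is_hike_pi s : is_hike (\pi_trace s) =
  [forall i, count (fun a => arc_src a == i) s
          == count (fun a => arc_tgt a == i) s].
Proof.
have /trace_eq_perm/permP e := trace_repr s.
by apply: eq_forallb => i; rewrite !e.
Qed.

Lemma is_hike_closed : monoid_closed is_hike.
Proof.
split=> [|x y].
  by rewrite -[_ \in _]/(is_hike _) is_hike_pi; apply/forallP.
rewrite -![_ \in _]/(is_hike _) -[x]reprK -[y]reprK.
rewrite [(_ * _)%g]trace_mul_pi !is_hike_pi.
move=> /forallP hs /forallP ht; apply/forallP => i.
by rewrite !count_cat (eqP (hs i)) (eqP (ht i)).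
Qed.

Record hike := Hike { hike_val :> trace; _ : is_hike hike_val }.
HB.instance Definition _ := [isSub for hike_val].
HB.instance Definition _ := [Choice of hike by <:].
HB.instance Definition _ :=
  SubChoice_isSubMonoid.Build trace is_hike hike is_hike_closed.

End TraceEq.

Section Divisors.
Variables (V : finType) (E : {set V * V}).
Implicit Types d h k : hike E.

Definition hike_divides d h : Prop := exists k, h = (d * k)%g.

(* The value is 1 when d does not divide h. *)
Definition hike_div h d : hike E := xget 1%g [set k | h = (d * k)%g].

Definition hike_divisors h : set (hike E) := [set d | hike_divides d h].

Definition hike_size h : nat := size (repr (hike_val h)).

Lemma trace_mulI (x y z : trace E) : (x * y)%g = (x * z)%g -> y = z.
Proof.
rewrite -[y]reprK -[z]reprK -[x]reprK.
rewrite [(_ * \pi_(trace E) (repr y))%g]trace_mul_pi.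
rewrite [(_ * \pi_(trace E) (repr z))%g]trace_mul_pi.
by move=> /trace_piP/trace_eq_catI/trace_piP.
Qed.

Lemma hike_mulI d h k : (d * h)%g = (d * k)%g -> h = k.
Proof. by move=> /(congr1 val) /trace_mulI /val_inj. Qed.

Lemma hike_sizeM d h : hike_size (d * h)%g = (hike_size d + hike_size h)%N.
Proof.
by rewrite /hike_size (perm_size (trace_eq_perm (trace_repr _))) size_cat.
Qed.

Lemma hike_size_eq0 h : (hike_size h == 0%N) = (h == 1%g).
Proof.
apply/idP/eqP => [/nilP hn|->].
  by apply/val_inj; rewrite -[val h]reprK hn.
by rewrite /hike_size (perm_size (trace_eq_perm (trace_repr _))).
Qed.

Lemma hike_size1 : hike_size 1%g = 0%N.
Proof. by apply/eqP; rewrite hike_size_eq0. Qed.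

Lemma hike_divE d h : hike_div (d * h)%g d = h.
Proof.
rewrite /hike_div; case: xgetP => [k _ /= /hike_mulI //|/(_ h) nh].
by exfalso; apply: nh.
Qed.

Lemma hike_size_finite n : finite_set [set h | (hike_size h <= n)%N].
Proof.
pose W := {i : 'I_n.+1 & i.-tuple (arc E)}.
pose F (w : W) : hike E := insubd 1%g (\pi_(trace E) (tagged w : seq _)).
apply: (@sub_finite_set _ _ (F @` [set: W])); last first.
  by apply: finite_image; apply: finite_finset.
move=> h /= hn; have ln : (hike_size h < n.+1)%N by [].
exists (@Tagged _ (Ordinal ln) (fun i : 'I_n.+1 => i.-tuple (arc E))
  (in_tuple (repr (hike_val h)))) => //=.
by rewrite /F /= reprK; apply: valKd.
Qed.

Lemma hike_divisors_finite h : finite_set (hike_divisors h).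
Proof.
apply: sub_finite_set (hike_size_finite (hike_size h)) => d /= [k ->].
by rewrite hike_sizeM leq_addr.
Qed.

End Divisors.

Section Dirichlet.
Variables (R : realType) (V : finType) (E : {set V * V}).
Implicit Types f g : hike E -> R.

(* The index set is finite by hike_divisors_finite, and the cofactor of d in h
   is unique by hike_mulI. *)
Definition dirichlet_conv f g : hike E -> R :=
  fun h => \sum_(d \in hike_divisors h) f d * g (hike_div h d).

Definition dirichlet_delta : hike E -> R := fun h => (h == 1%g)%:R.

Definition is_dirichlet_inverse f g : Prop :=
  dirichlet_conv f g = dirichlet_delta /\ dirichlet_conv g f = dirichlet_delta.

Let hikes n : seq (hike E) :=
  finmap.enum_fset (fset_set [set h : hike E | (hike_size h <= n)%N]).

Let mem_hikes n h : (h \in hikes n) = (hike_size h <= n)%N.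
Proof.
rewrite [LHS]in_fset_set; last exact: hike_size_finite.
by apply/idP/idP; rewrite inE.
Qed.

Let sum_hikes_eq n (F : hike E -> R) h : (hike_size h <= n)%N ->
  \sum_(k <- hikes n) (h == k)%:R * F k = F h.
Proof.
move=> hn; rewrite (bigD1_seq h) ?mem_hikes ?finmap.fset_uniq//= eqxx mul1r.
rewrite big1 ?addr0// => k; rewrite eq_sym => /negPf ->; exact: mul0r.
Qed.

Let convE n f g h : (hike_size h <= n)%N -> dirichlet_conv f g h =
  \sum_(a <- hikes n) \sum_(b <- hikes n) (a * b == h)%g%:R * (f a * g b).
Proof.
move=> hn.
have dn d : hike_divides d h -> d \in hikes n.
  case=> k hE; rewrite mem_hikes; apply: leq_trans hn.
  by rewrite hE hike_sizeM leq_addr.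
rewrite /dirichlet_conv (fsbigE [seq d <- hikes n | d \in hike_divisors h]).
- rewrite big_filter_cond big_mkcond; apply: eq_bigr => d _.
  rewrite andbb; case: ifPn => [|/negP hd].
    rewrite inE => -[k hE]; rewrite hE hike_divE.
    rewrite -[LHS](@sum_hikes_eq n (fun b => f d * g b)); last first.
      by apply: leq_trans hn; rewrite hE hike_sizeM leq_addl.
    apply: eq_bigr => b _; congr (_%:R * _); congr nat_of_bool.
    by rewrite eq_sym; apply/eqP/eqP => [->|/hike_mulI].
  rewrite big1 // => b _; case: eqP => [hE|_]; last exact: mul0r.
  by case: hd; rewrite inE; exists b.
- by rewrite filter_uniq// finmap.fset_uniq.
- by move=> d /=; rewrite mem_filter => /andP[]; rewrite inE.
- by move=> d hd; rewrite mem_filter mem_set// dn.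
Qed.

Let hikeM_eq n (p c h : hike E) : (hike_size h <= n)%N ->
  \sum_(x <- hikes n) (p == x)%:R * (x * c == h)%g%:R = (p * c == h)%g%:R :> R.
Proof.
move=> hn; have [pn|pn] := leqP (hike_size p) n.
  by rewrite (@sum_hikes_eq n (fun x => (x * c == h)%g%:R)).
rewrite big_seq big1 => [|x]; last first.
  rewrite mem_hikes => xn; case: eqP => [px|_]; last exact: mul0r.
  by move: pn; rewrite px ltnNge xn.
case: eqP => // hE; move: pn; rewrite ltnNge (leq_trans _ hn)//.
by rewrite -hE hike_sizeM leq_addr.
Qed.

Let hikeM_eqr n (p c h : hike E) : (hike_size h <= n)%N ->
  \sum_(x <- hikes n) (p == x)%:R * (c * x == h)%g%:R = (c * p == h)%g%:R :> R.
Proof.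
move=> hn; have [pn|pn] := leqP (hike_size p) n.
  by rewrite (@sum_hikes_eq n (fun x => (c * x == h)%g%:R)).
rewrite big_seq big1 => [|x]; last first.
  rewrite mem_hikes => xn; case: eqP => [px|_]; last exact: mul0r.
  by move: pn; rewrite px ltnNge xn.
case: eqP => // hE; move: pn; rewrite ltnNge (leq_trans _ hn)//.
by rewrite -hE hike_sizeM leq_addl.
Qed.

Lemma dirichlet_convA : associative dirichlet_conv.
Proof.
move=> f g k; apply/funext => h; set n := hike_size h.
transitivity (\sum_(a <- hikes n) \sum_(b <- hikes n) \sum_(c <- hikes n)
   (a * b * c == h)%g%:R * (f a * g b * k c)).
  rewrite (@convE n)//; apply: eq_bigr => a _.
  under eq_big_seq => y; first rewrite mem_hikes => yn.
    rewrite (@convE n)// !mulr_sumr.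
    under eq_bigr do rewrite !mulr_sumr.
    over.
  rewrite exchange_big; apply: eq_bigr => b _ /=.
  rewrite exchange_big; apply: eq_bigr => c _ /=.
  rewrite -mulgA -(@hikeM_eqr n)// mulr_suml; apply: eq_bigr => y _.
  by ring.
rewrite (@convE n)//.
under [RHS]eq_big_seq => x; first rewrite mem_hikes => xn.
  under eq_bigr do rewrite (@convE n)// mulr_suml mulr_sumr.
  over.
under [RHS]eq_bigr do rewrite exchange_big.
rewrite [RHS]exchange_big; apply: eq_bigr => a _ /=.
under [RHS]eq_bigr => x _.
  under eq_bigr do rewrite mulr_suml mulr_sumr.
  rewrite exchange_big; over.
rewrite [RHS]exchange_big; apply: eq_bigr => b _ /=.
rewrite [RHS]exchange_big; apply: eq_bigr => c _ /=.
rewrite -(@hikeM_eq n)// mulr_suml; apply: eq_bigr => x _.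
by ring.
Qed.

Lemma dirichlet_conv1 : right_id dirichlet_delta dirichlet_conv.
Proof.
move=> f; apply/funext => h; rewrite (@convE (hike_size h))//.
rewrite -[RHS](@sum_hikes_eq (hike_size h))//; apply: eq_bigr => a _.
under eq_bigr => b _ do
  rewrite /dirichlet_delta (eq_sym b) (mulrC (f a)) mulrCA.
rewrite (sum_hikes_eq (fun b => (a * b == h)%g%:R * f a)).
  by rewrite mulg1 eq_sym.
by rewrite hike_size1.
Qed.

Lemma dirichlet_conv1l : left_id dirichlet_delta dirichlet_conv.
Proof.
move=> f; apply/funext => h; rewrite (@convE (hike_size h))// exchange_big.
rewrite -[RHS](@sum_hikes_eq (hike_size h))//; apply: eq_bigr => b _ /=.
under eq_bigr => a _ do rewrite /dirichlet_delta (eq_sym a) mulrCA.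
rewrite (sum_hikes_eq (fun a => (a * b == h)%g%:R * f b)).
  by rewrite mul1g eq_sym.
by rewrite hike_size1.
Qed.

Let right_inverse_ex f : f 1%g = 1 ->
  exists2 g, g 1%g = 1 & dirichlet_conv f g = dirichlet_delta.
Proof.
move=> f1.
pose step (g : hike E -> R) h := dirichlet_delta h -
  \sum_(d \in hike_divisors h `\ 1%g) f d * g (hike_div h d).
pose ri n := iter n step (fun=> 0).
have riE n m h : (hike_size h < n)%N -> (hike_size h < m)%N -> ri n h = ri m h.
  elim: n m h => [//|n IH] [//|m] h hn hm; congr (_ - _).
  apply: eq_fsbigr => d; rewrite inE => -[[k hE] /eqP d1].
  congr (_ * _); rewrite hE hike_divE; move: hn hm d1.
  rewrite hE hike_sizeM -hike_size_eq0 -lt0n => hn hm d1.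
  have kd : (hike_size k < hike_size d + hike_size k)%N.
    by rewrite -{1}[hike_size k]add0n ltn_add2r.
  by apply: IH; apply: leq_trans kd _.
pose g h := ri (hike_size h).+1 h.
have gE h : g h = step g h.
  congr (_ - _); apply: eq_fsbigr => d; rewrite inE => -[[k hE] /eqP d1].
  congr (_ * _); rewrite hE hike_divE; apply: riE => //.
  rewrite [ltnRHS]hike_sizeM -{1}[hike_size k]add0n ltn_add2r lt0n.
  by rewrite hike_size_eq0.
exists g.
  rewrite gE /step fsbig1 ?subr0 /dirichlet_delta ?eqxx// => d [[k dk] d1].
  exfalso; apply: d1; apply/eqP; rewrite -hike_size_eq0 -leqn0.
  by rewrite -(@hike_size1 _ E) dk hike_sizeM leq_addr.
apply/funext => h; rewrite /dirichlet_conv (fsbigD1 1%g); first last.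
- by exists h; rewrite mul1g.
- exact: hike_divisors_finite.
rewrite f1 mul1r; have -> : hike_div h 1%g = h.
  by rewrite -{1}[h]mul1g hike_divE.
by rewrite /= [X in X + _]gE /step subrK.
Qed.

Lemma dirichlet_inverse_ex f : f 1%g = 1 -> exists g, is_dirichlet_inverse f g.
Proof.
move=> /right_inverse_ex[g /right_inverse_ex[k _ gk] fg].
exists g; split=> //; suff -> : f = k by [].
by rewrite -[RHS]dirichlet_conv1l -fg -dirichlet_convA gk dirichlet_conv1.
Qed.

(* By mobiusP, the inverse of the constant function 1 exists, so that the
   default value is never used. *)
Definition mobius : hike E -> R :=
  xget (fun=> 0) [set m | is_dirichlet_inverse (fun=> 1) m].

Lemma mobiusP : is_dirichlet_inverse (fun=> 1) mobius.
Proof.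
rewrite /mobius; case: xgetP => [m _ //|nm].
by have [g /nm] := @dirichlet_inverse_ex (fun=> 1) erefl.
Qed.

Definition totally_multiplicative f : Prop :=
  forall h h', f (h * h')%g = f h * f h'.

End Dirichlet.

Arguments mobius R {V} E.

(* Main.v *)
(** Total multiplicativity pulls [f h = f d * f (h / d)] out of every term of a
    convolution, so twisting by [f] is compatible with the Dirichlet convolution
    and fixes its unit; twisting [1 * mu = delta] by [f] gives the inverse. *)
Require Import Defs.
From mathcomp Require Import all_boot all_order all_algebra.
From mathcomp Require Import all_classical all_reals.

Import GRing.Theory.

Local Open Scope ring_scope.

Section TotallyMultiplicative.
Context {R : realType} {V : finType} {E : {set V * V}}.
Implicit Types f g k : hike E -> R.

(** Cancel [f h] in [f 1 * f h = f h] at a point where [f] does not vanish; the zero function is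
    multiplicative too, but has no inverse. *)
Lemma totally_multiplicative1 f :
  (exists h, f h <> 0) -> totally_multiplicative f -> f 1%g = 1.
Proof.
move=> [h /eqP fh0] fM; apply: (mulIf fh0).
by rewrite -fM mul1g mul1r.
Qed.

Lemma dirichlet_conv_twist f g k : totally_multiplicative f ->
  dirichlet_conv (fun h => g h * f h) (fun h => k h * f h) =
  fun h => dirichlet_conv g k h * f h.
Proof.
move=> fM; apply/funext => h.
rewrite /dirichlet_conv !fsbig_finite; try exact: hike_divisors_finite.
rewrite /= mulr_suml; apply: eq_big_seq => d.
rewrite in_fset_set; last exact: hike_divisors_finite.
(* Writing [h] as [d * c] turns the cofactor into [c] by left cancellation, and [f h] into
   [f d * f c]. *)
rewrite inE => -[c ->]; rewrite hike_divE fM.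
by rewrite mulrACA.
Qed.

Lemma dirichlet_inverse_twist f g k : f 1%g = 1 -> totally_multiplicative f ->
  is_dirichlet_inverse g k ->
  is_dirichlet_inverse (fun h => g h * f h) (fun h => k h * f h).
Proof.
move=> f1 fM [gk kg].
have deltaf : (fun h => dirichlet_delta R h * f h) = dirichlet_delta R (E := E).
  apply/funext => h; rewrite /dirichlet_delta.
  (* Only the value of [f] at the empty hike matters here. *)
  by case: eqP => [->|_]; rewrite ?f1 ?mulr1 ?mul0r.
by split; rewrite dirichlet_conv_twist// ?gk ?kg.
Qed.

(** The usual monoid argument: [g = g * (f * k) = (g * f) * k = k]. *)
Lemma dirichlet_inverse_unique f g k :
  is_dirichlet_inverse f g -> is_dirichlet_inverse f k -> g = k.
Proof.
move=> [_ gf] [fk _].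
by rewrite -[g]dirichlet_conv1 -fk dirichlet_convA gf dirichlet_conv1l.
Qed.

End TotallyMultiplicative.

Theorem lemma3p7 (R : realType) (V : finType) (E : {set V * V})
    (f : hike E -> R) (f_neq0 : exists h, f h <> 0)
    (fM : totally_multiplicative f) :
  is_dirichlet_inverse f (fun h => mobius R E h * f h) /\
  (forall g : hike E -> R, is_dirichlet_inverse f g ->
     g = fun h => mobius R E h * f h).
Proof.
have f1 := totally_multiplicative1 f f_neq0 fM.
have inv_f : is_dirichlet_inverse f (fun h => mobius R E h * f h).
  have := dirichlet_inverse_twist f _ _ f1 fM (mobiusP R E).
  (* The twist of the constant function 1 by [f] is [f] itself. *)
  by under eq_fun do rewrite mul1r.
by split=> // g /dirichlet_inverse_unique; apply.
Qed.
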